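(* Let $M$ be a Riemannian manifold with an $r$-fold VCP $\chi$, and let $\tau\in\Omega^{r+1}(M,\mathbf g_M^\perp)$ be the associated tensor. Then an $(r+1)$-dimensional submanifold $A\subset M$ is an instanton if and only if $$\tau|_A=0\in\Omega^{r+1}(A,\mathbf g_M^\perp).$$
   Context: An $r$-fold vector cross product (VCP) on $(M,g)$ is a smooth bundle map $\chi:\wedge^rTM\to TM$ with $g(\chi(v_1,\dots,v_r),v_i)=0$ for all $i$ and $|\chi(v_1,\dots,v_r)|=\|v_1\wedge\cdots\wedge v_r\|$. An instanton is an $(r+1)$-dimensional submanifold $A$ preserved by $\chi$: $\chi(v_1,\dots,v_r)\in T_xA$ for all $v_i\in T_xA$, $x\in A$. The tensor $\tau$ is defined fibrewise by $$\tau(v_1,\dots,v_{r+1})=\frac1{\sqrt{r+1}}\sum_{k=1}^{r+1}(-1)^{k-1}v_k\wedge\chi(v_1,\dots,\widehat{v_k},\dots,v_{r+1})\in\wedge^2TM.$$ $\mathbf g_M\subset\Lambda^2T_M^*\cong\mathbf{so}(TM)$ is the subbundle whose fibre consists of the infinitesimal isometries $\zeta$ preserving $\chi$, i.e. $\zeta(\chi(v_1,\dots,v_r))=\sum_i\chi(v_1,\dots,\zeta(v_i),\dots,v_r)$. $\mathbf g_M^\perp\subset\wedge^2TM$ is its annihilator under the natural pairing of $\wedge^2TM$ and $\wedge^2T^*M$; $\tau$ takes values in $\mathbf g_M^\perp$. $\tau|_A$ denotes the restriction of $\tau$, as an $(r+1)$-form, to tangent vectors of $A$. *)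

(* Defs.v *)
From HB Require Import structures.
From mathcomp Require Import all_boot all_order all_algebra all_fingroup.
From mathcomp Require Import all_classical all_reals all_analysis.

Set Implicit Arguments.
Unset Strict Implicit.
Unset Printing Implicit Defensive.

Import Order.TTheory GRing.Theory Num.Theory.
Import numFieldNormedType.Exports.

Local Open Scope classical_set_scope.
Local Open Scope ring_scope.

(* [Ck k U f], for U open: f has continuous iterated differentials up to
   order k on U.  The differential is taken direction by direction, which is
   the usual notion since the source is finite-dimensional. *)
Fixpoint Ck {R : realType} {n : nat} {W : normedModType R} (k : nat)
    (U : set 'rV[R]_n) (f : 'rV[R]_n -> W) : Prop :=
  if k is k'.+1 then
    (forall z, U z -> differentiable f z)
    /\ forall u : 'rV[R]_n, Ck k' U (fun z => 'd f z u)
  else forall z, U z -> {for z, continuous f}.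

Definition smooth_on {R : realType} {n : nat} {W : normedModType R}
    (U : set 'rV[R]_n) (f : 'rV[R]_n -> W) : Prop :=
  forall k, Ck k U f.

Record chart (R : realType) (T : topologicalType) (n : nat) := Chart {
  cdom : set T;
  cimg : set 'rV[R]_n;
  cmap : T -> 'rV[R]_n;
  cinv : 'rV[R]_n -> T;
  cdom_open : open cdom;
  cimg_open : open cimg;
  cmap_img : forall x, cdom x -> cimg (cmap x);
  cinv_dom : forall z, cimg z -> cdom (cinv z);
  cmapK : forall x, cdom x -> cinv (cmap x) = x;
  cinvK : forall z, cimg z -> cmap (cinv z) = z;
  cmap_continuous : forall x, cdom x -> {for x, continuous cmap};
  cinv_continuous : forall z, cimg z -> {for z, continuous cinv} }.

(* [chart_at x] is a preferred chart of the atlas around x; it serves only to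
   give a concrete model of the tangent space at x. *)
Record manifold (R : realType) (n : nat) := Manifold {
  carrier :> topologicalType;
  manifold_hausdorff : hausdorff_space carrier;
  manifold_second_countable : @second_countable carrier;
  atlas : set (chart R carrier n);
  chart_at : carrier -> chart R carrier n;
  chart_at_atlas : forall x, atlas (chart_at x);
  mem_chart_at : forall x, cdom (chart_at x) x;
  atlas_smooth : forall c d, atlas c -> atlas d ->
    smooth_on [set z | cimg c z /\ cdom d (cinv c z)] (cmap d \o cinv c) }.

Arguments atlas {R n} M : rename.
Arguments chart_at {R n M} x : rename.

(* T_x M is R^n, a vector being identified with its components in the chart
   [chart_at x]; components in another chart are given by [frame] and
   [components] below. *)
Definition tangent {R : realType} {n : nat} {M : manifold R n} (x : M) : Type :=
  'rV[R]_n.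

HB.instance Definition _ (R : realType) (n : nat) (M : manifold R n) (x : M) :=
  GRing.Lmodule.copy (tangent x) 'rV[R]_n.

(* Tangent vector at the point of coordinates z in the chart c whose
   components in c are u. *)
Definition frame {R : realType} {n : nat} {M : manifold R n}
    (c : chart R M n) (z u : 'rV[R]_n) : tangent (cinv c z) :=
  'd (cmap (chart_at (cinv c z)) \o cinv c) z u.

Definition components {R : realType} {n : nat} {M : manifold R n}
    (c : chart R M n) (x : M) (v : tangent x) : 'rV[R]_n :=
  'd (cmap c \o cinv (chart_at x)) (cmap (chart_at x) x) v.

Definition smooth_map {R : realType} {k n : nat}
    {A : manifold R k} {M : manifold R n} (f : A -> M) : Prop :=
  continuous f /\
  forall c d, atlas A c -> atlas M d ->
    smooth_on [set z | cimg c z /\ cdom d (f (cinv c z))]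
      (cmap d \o f \o cinv c).

Definition tmap {R : realType} {k n : nat}
    {A : manifold R k} {M : manifold R n} (f : A -> M) (a : A)
    : tangent a -> tangent (f a) :=
  'd (cmap (chart_at (f a)) \o f \o cinv (chart_at a)) (cmap (chart_at a) a).

Arguments tmap {R k n A M} f a _.

Lemma tmap_linear {R : realType} {k n : nat}
    {A : manifold R k} {M : manifold R n} (f : A -> M) (a : A) :
  linear (tmap f a).
Proof. by move=> s u w; rewrite /tmap linearP. Qed.

Arguments tmap_linear {R k n A M} f a.

(* A submanifold A of M is given by its inclusion, an injective immersion;
   regular (embedded) submanifolds are those for which the inclusion is
   moreover a homeomorphism onto its image. *)
Record submanifold {R : realType} {n : nat} (M : manifold R n) (k : nat) :=
  Submanifold {
    submanifold_dom :> manifold R k;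
    inclusion : submanifold_dom -> M;
    inclusion_inj : injective inclusion;
    inclusion_smooth : smooth_map inclusion;
    inclusion_immersion : forall a, injective (tmap inclusion a) }.

Arguments inclusion {R n M k} s _ : rename.

Definition subst_at {r : nat} {V : Type} (v : 'I_r -> V) (i : 'I_r) (u : V)
    : 'I_r -> V :=
  fun j => if j == i then u else v j.

Definition multilinear {R : pzRingType} {V W : lmodType R} {r : nat}
    (f : ('I_r -> V) -> W) : Prop :=
  forall (v : 'I_r -> V) (i : 'I_r), linear (fun u => f (subst_at v i u)).

Definition alternating {R : pzRingType} {V W : lmodType R} {r : nat}
    (f : ('I_r -> V) -> W) : Prop :=
  forall (v : 'I_r -> V) (i j : 'I_r), i != j -> v i = v j -> f v = 0.

(* Linear maps from the r-th exterior power of V to W, through the universal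
   property of the exterior power. *)
Record altform {R : pzRingType} (r : nat) (V W : lmodType R) := Altform {
  altform_fun :> ('I_r -> V) -> W;
  altform_multilinear : multilinear altform_fun;
  altform_alternating : alternating altform_fun }.

Lemma altform_eq {R : pzRingType} (r : nat) (V W : lmodType R)
    (f h : altform r V W) : (forall v, f v = h v) -> f = h.
Proof.
case: f h => [f fm fa] [h hm ha] /= fh.
have {fh}E : f = h by apply: funext.
by subst h; congr Altform; exact: Prop_irrelevance.
Qed.

Section Zero.
Context {R : pzRingType} (r : nat) (V W : lmodType R).

Lemma altform0_multilinear : multilinear (fun _ : 'I_r -> V => 0 : W).
Proof. by move=> v i s u w /=; rewrite scaler0 addr0. Qed.

Lemma altform0_alternating : alternating (fun _ : 'I_r -> V => 0 : W).
Proof. by []. Qed.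

Definition altform0 : altform r V W :=
  Altform altform0_multilinear altform0_alternating.
End Zero.

Section Pullback.
Context {R : pzRingType} {r : nat} {U V W : lmodType R}.
Variables (f : altform r V W) (h : U -> V) (hl : linear h).

Lemma altform_pullback_multilinear :
  multilinear (fun v : 'I_r -> U => f (fun i => h (v i))).
Proof.
move=> v i s u w /=.
have E y : (fun j => h (subst_at v i y j))
         = subst_at (fun j => h (v j)) i (h y).
  by apply: funext => j; rewrite /subst_at; case: ifP.
by rewrite !E hl (altform_multilinear f).
Qed.

Lemma altform_pullback_alternating :
  alternating (fun v : 'I_r -> U => f (fun i => h (v i))).
Proof.
by move=> v i j ij vij; apply: (altform_alternating f ij); rewrite vij.
Qed.

Definition altform_pullback : altform r U W :=
  Altform altform_pullback_multilinear altform_pullback_alternating.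
End Pullback.

Section AltTheory.
Context {R : pzRingType} {V W : lmodType R} {r : nat}.
Variable f : ('I_r -> V) -> W.
Hypotheses (fm : multilinear f) (fa : alternating f).

Lemma multilinearD (v : 'I_r -> V) i u w :
  f (subst_at v i (u + w)) = f (subst_at v i u) + f (subst_at v i w).
Proof. by have := fm v i 1 u w; rewrite !scale1r. Qed.

Lemma alt_tperm v i j : i != j -> f (v \o tperm i j) = - f v.
Proof.
move=> ij.
pose F a b := f (subst_at (subst_at v i a) j b).
have FDl a a' b : F (a + a') b = F a b + F a' b.
  have C x : subst_at (subst_at v i x) j b
      = subst_at (subst_at v j b) i x.
    apply: funext => k; rewrite /subst_at; case: (eqVneq k j) => [->|//].
    by rewrite eq_sym (negPf ij).
  by rewrite /F !C multilinearD.
have FDr a b b' : F a (b + b') = F a b + F a b' by rewrite /F multilinearD.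
have F0 a : F a a = 0.
  by apply: (@fa _ i j) => //; rewrite /subst_at !eqxx (negPf ij).
have E1 : f v = F (v i) (v j).
  by congr f; apply: funext => k; rewrite /subst_at; do 2?case: eqP => [->|_].
have E2 : f (v \o tperm i j) = F (v j) (v i).
  congr f; apply: funext => k; rewrite /subst_at /=; case: tpermP => [->|->|].
  - by rewrite (negPf ij) eqxx.
  - by rewrite eqxx.
  - by move=> /eqP/negPf-> /eqP/negPf->.
rewrite E1 E2; apply/eqP; rewrite -subr_eq0 opprK; apply/eqP.
have := F0 (v i + v j).
by rewrite FDl !FDr !F0 addr0 add0r addrC.
Qed.

Lemma alt_perm (s : 'S_r) v : f (v \o s) = (-1) ^+ s *: f v.
Proof.
case: (prod_tpermP s) => ts -> {s}.
elim: ts v => [|t ts IH] v /=.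
  move=> _; rewrite big_nil odd_perm1 scale1r; congr f.
  by apply: funext => k /=; rewrite perm1.
case/andP => td tsd; rewrite big_cons.
set p := (\prod_(t <- ts) _)%g in IH *.
have -> : v \o (tperm t.1 t.2 * p)%g = (v \o p) \o tperm t.1 t.2.
  by apply: funext => k /=; rewrite permM.
rewrite alt_tperm // IH // odd_mul_tperm td /=.
by rewrite signrN scaleNr.
Qed.
End AltTheory.

(* The exterior square of R^n as the space of skew tensors, u /\ v being
   u (x) v - v (x) u. *)
Definition skew {R : pzRingType} {n : nat} : {pred 'M[R]_n} :=
  fun B => B^T == - B.

Lemma skew_submod_closed {R : pzRingType} {n : nat} :
  submod_closed (@skew R n).
Proof.
split; first by rewrite /skew unfold_in trmx0 oppr0.
move=> a B C; rewrite !unfold_in => /eqP hB /eqP hC.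
by rewrite linearD linearZ /= hB hC scalerN opprD.
Qed.

HB.instance Definition _ (R : pzRingType) (n : nat) :=
  GRing.isSubmodClosed.Build R 'M[R]_n (@skew R n) skew_submod_closed.

Record bivector (R : pzRingType) (n : nat) := Bivector {
  bivector_mx :> 'M[R]_n;
  bivector_skew : bivector_mx \in skew }.

HB.instance Definition _ (R : pzRingType) (n : nat) :=
  [isSub for @bivector_mx R n].
HB.instance Definition _ (R : pzRingType) (n : nat) :=
  [Choice of bivector R n by <:].
HB.instance Definition _ (R : pzRingType) (n : nat) :=
  [SubChoice_isSubLmodule of bivector R n by <:].

Section Wedge.
Context {R : comPzRingType} {n : nat}.
Implicit Types u v w : 'rV[R]_n.

Lemma wedge_skew u v : u^T *m v - v^T *m u \in skew.
Proof.
by rewrite unfold_in linearB /= !trmx_mul !trmxK opprB.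
Qed.

Definition wedge u v : bivector R n := Bivector (wedge_skew u v).

Lemma wedgePl v : linear (wedge^~ v).
Proof.
move=> a u w; apply: val_inj; rewrite [RHS]linearP /=.
rewrite [(_ + _)^T]linearP /= mulmxDl mulmxDr scalerBr -!scalemxAl -scalemxAr.
by rewrite opprD addrACA.
Qed.

Lemma wedgePr u : linear (wedge u).
Proof.
move=> a v w; apply: val_inj; rewrite [RHS]linearP /=.
rewrite [(_ + _)^T]linearP /= mulmxDl mulmxDr scalerBr -!scalemxAl -scalemxAr.
by rewrite opprD addrACA.
Qed.

Lemma wedge0r u : wedge u 0 = 0.
Proof.
by have := wedgePr u (-1) 0 0; rewrite scaler0 addr0 scaleN1r addNr.
Qed.

Lemma wedgeZr u a v : wedge u (a *: v) = a *: wedge u v.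
Proof. by have := wedgePr u a v 0; rewrite !addr0 wedge0r addr0. Qed.

(* Natural pairing of a 2-form omega = \sum_(i<j) omega_ij e^i /\ e^j with a
   bivector B = \sum_(i<j) B_ij e_i /\ e_j. *)
Definition pairing (omega : 'rV[R]_n -> 'rV[R]_n -> R) (B : bivector R n) : R :=
  \sum_(i < n) \sum_(j < n | (i < j)%N)
    omega (delta_mx 0 i) (delta_mx 0 j) * B i j.

Lemma pairingP omega a B C :
  pairing omega (a *: B + C) = a * pairing omega B + pairing omega C.
Proof.
rewrite /pairing mulr_sumr -big_split; apply: eq_bigr => i _.
rewrite mulr_sumr -big_split; apply: eq_bigr => j _ /=.
by rewrite !mxE mulrDr mulrCA.
Qed.

Lemma pairing_wedge (omega : 'rV[R]_n -> 'rV[R]_n -> R) u v :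
  (forall w, linear (omega w : 'rV[R]_n -> R^o)) ->
  (forall w, linear (omega^~ w : 'rV[R]_n -> R^o)) ->
  (forall w, omega w w = 0) ->
  pairing omega (wedge u v) = omega u v.
Proof.
move=> lr ll alt.
have anti a b : omega a b = - omega b a.
  have D1 x y z : omega x (y + z) = omega x y + omega x z.
    by have := lr x 1 y z; rewrite !scale1r.
  have D2 x y z : omega (y + z) x = omega y x + omega z x.
    by have := ll x 1 y z; rewrite !scale1r.
  have := alt (a + b); rewrite D1 !D2 !alt add0r addr0 => /eqP.
  by rewrite addr_eq0 => /eqP ->; rewrite opprK.
pose e (i : 'I_n) := delta_mx 0 i : 'rV[R]_n.
have Er w a : omega w a = \sum_j a 0 j * omega w (e j).
  have D1 x y : omega w (x + y) = omega w x + omega w y.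
    by have := lr w 1 x y; rewrite !scale1r.
  have D0 : omega w 0 = 0.
    by apply: (addrI (omega w 0)); rewrite -D1 !addr0.
  have DZ c x : omega w (c *: x) = c * omega w x.
    by have := lr w c x 0; rewrite addr0 D0 addr0.
  rewrite {1}(row_sum_delta a) (big_morph (omega w) D1 D0).
  by apply: eq_bigr => j _; rewrite DZ.
have El w a : omega a w = \sum_j a 0 j * omega (e j) w.
  by rewrite anti Er -sumrN; apply: eq_bigr => j _; rewrite -mulrN -anti.
have -> : omega u v = \sum_i \sum_j u 0 i * v 0 j * omega (e i) (e j).
  rewrite El; apply: eq_bigr => i _; rewrite Er mulr_sumr.
  by apply: eq_bigr => j _; rewrite mulrA.
rewrite /pairing.
transitivity (\sum_(i < n)
    (\sum_(j < n | (i < j)%N) u 0 i * v 0 j * omega (e i) (e j)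
     + \sum_(j < n | (j < i)%N) u 0 i * v 0 j * omega (e i) (e j))).
  rewrite big_split /=.
  rewrite [X in _ = _ + X](exchange_big_dep xpredT) //= -big_split /=.
  apply: eq_bigr => i _; rewrite -big_split /=; apply: eq_bigr => j _.
  rewrite !mxE !big_ord1 !mxE (anti (e j) (e i)) -/(e i) -/(e j).
  by rewrite mulrN -mulrBl mulrC (mulrC (v 0 i)).
apply: eq_bigr => i _; rewrite [RHS](bigID (fun j : 'I_n => (i < j)%N)) /=.
congr (_ + _); rewrite [RHS](bigID (fun j : 'I_n => (j < i)%N)) /=.
rewrite [X in _ = _ + X]big1 ?addr0; last first.
  move=> j; rewrite -!leqNgt => ?.
  have -> : j = i by apply/val_inj/anti_leq.
  by rewrite alt mulr0.
by apply: eq_bigl => j; case: ltngtP.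
Qed.
End Wedge.

Record riemannian_metric {R : realType} {n : nat} (M : manifold R n) :=
  RiemannianMetric {
    metric :> forall x : M, tangent x -> tangent x -> R;
    metric_linear : forall (x : M) (w : tangent x),
      linear (fun v => metric v w : R^o);
    metric_symmetric : forall (x : M) (v w : tangent x), metric v w = metric w v;
    metric_pos : forall (x : M) (v : tangent x), v != 0 -> 0 < metric v v;
    metric_smooth : forall c, atlas M c -> forall u w : 'rV[R]_n,
      smooth_on (cimg c)
        (fun z => metric (frame c z u) (frame c z w) : R^o) }.

Definition metric_norm {R : realType} {n : nat} {M : manifold R n}
    (g : riemannian_metric M) (x : M) (v : tangent x) : R :=
  Num.sqrt (g x v v).

(* Norm of v_1 /\ ... /\ v_r for the inner product induced by g on the r-th
   exterior power, <v_1 /\ ... /\ v_r, w_1 /\ ... /\ w_r> = det (g(v_i, w_j)). *)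
Definition wedge_norm {R : realType} {n : nat} {M : manifold R n}
    (g : riemannian_metric M) (r : nat) (x : M) (v : 'I_r -> tangent x) : R :=
  Num.sqrt (\det (\matrix_(i < r, j < r) g x (v i) (v j))).

Record vcp {R : realType} {n : nat} {M : manifold R n}
    (g : riemannian_metric M) (r : nat) := VCP {
  vcp_form :> forall x : M, altform r (tangent x) (tangent x);
  vcp_smooth : forall c, atlas M c -> forall u : 'I_r -> 'rV[R]_n,
    smooth_on (cimg c)
      (fun z => components c (vcp_form (cinv c z) (fun i => frame c z (u i))));
  vcp_orthogonal : forall (x : M) (v : 'I_r -> tangent x) (i : 'I_r),
    g x (vcp_form x v) (v i) = 0;
  vcp_norm : forall (x : M) (v : 'I_r -> tangent x),
    metric_norm g (vcp_form x v) = wedge_norm g v }.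

Definition instanton {R : realType} {n : nat} {M : manifold R n}
    {g : riemannian_metric M} {r : nat} (chi : vcp g r)
    (A : submanifold M r.+1) : Prop :=
  forall (a : A) (v : 'I_r -> tangent (inclusion A a)),
    (forall i, range (tmap (inclusion A) a) (v i)) ->
    range (tmap (inclusion A) a) (chi (inclusion A a) v).

Definition ext2 {R : realType} {n : nat} {M : manifold R n} (x : M) : Type :=
  bivector R n.

HB.instance Definition _ (R : realType) (n : nat) (M : manifold R n) (x : M) :=
  GRing.Lmodule.copy (ext2 x) (bivector R n).

Section Tau.
Context {R : realType} {n : nat} {M : manifold R n}.
Context {g : riemannian_metric M} {r : nat} (chi : vcp g r).
Implicit Types x : M.

Definition g_fibre x : set {linear tangent x -> tangent x} :=
  [set zeta | (forall v w, g x (zeta v) w = - g x v (zeta w)) /\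
              (forall v : 'I_r -> tangent x,
                 zeta (chi x v) = \sum_i chi x (subst_at v i (zeta (v i))))].

Arguments g_fibre : clear implicits.

(* The identification of so(T_x M) with 2-forms. *)
Definition two_form x (zeta : {linear tangent x -> tangent x})
    (v w : tangent x) : R := g x (zeta v) w.

Definition annihilates_g x : {pred ext2 x} :=
  fun B => `[< forall zeta, g_fibre x zeta -> pairing (two_form zeta) B = 0 >].

Arguments annihilates_g : clear implicits.

Lemma annihilates_g_submod_closed x : submod_closed (annihilates_g x).
Proof.
split; rewrite /annihilates_g.
  apply/asboolP => zeta _; rewrite /pairing big1 // => i _.
  by rewrite big1 // => j _; rewrite mxE mulr0.
move=> a B C; rewrite !unfold_in => /asboolP hB /asboolP hC.
by apply/asboolP => zeta hz; rewrite pairingP hB // hC // mulr0 addr0.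
Qed.

HB.instance Definition _ x :=
  GRing.isSubmodClosed.Build R (ext2 x) (annihilates_g x)
    (annihilates_g_submod_closed x).

Record gperp x := Gperp {
  gperp_ext2 :> ext2 x;
  gperp_annihilates : gperp_ext2 \in annihilates_g x }.

HB.instance Definition _ x := [isSub for @gperp_ext2 x].
HB.instance Definition _ x := [Choice of gperp x by <:].
HB.instance Definition _ x := [SubChoice_isSubLmodule of gperp x by <:].

(* Indices start at 0 here, whence the sign (-1)^k. *)
Definition tau_ext2 x (v : 'I_r.+1 -> tangent x) : ext2 x :=
  (Num.sqrt r.+1%:R)^-1 *:
    \sum_(k < r.+1) (-1) ^+ k *: wedge (v k) (chi x (v \o lift k)).

Lemma tau_ext2_multilinear x : multilinear (@tau_ext2 x).
Proof.
move=> v i a u w; rewrite /tau_ext2.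
rewrite scalerA mulrC -scalerA -scalerDr; congr (_ *: _).
rewrite scaler_sumr -big_split; apply: eq_bigr => k _ /=.
rewrite scalerA mulrC -scalerA -scalerDr; congr (_ *: _).
have [->|ki] := eqVneq k i.
  have E y : subst_at v i y \o lift i = v \o lift i.
    by apply: funext => j; rewrite /subst_at /= eq_sym (negPf (neq_lift i j)).
  by rewrite !E /subst_at !eqxx wedgePl.
have [i' ->] : exists i', i = lift k i'.
  by case: (unliftP k i) => [i' ->|ik]; [exists i'|rewrite ik eqxx in ki].
have E y : subst_at v (lift k i') y \o lift k = subst_at (v \o lift k) i' y.
  by apply: funext => j; rewrite /subst_at /= (inj_eq (@lift_inj _ k)).
rewrite !E (altform_multilinear (chi x)).
have E' y : subst_at v (lift k i') y k = v k.
  by rewrite /subst_at (negPf (neq_lift k i')).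
by rewrite !E' wedgePr.
Qed.

Lemma tau_ext2_alternating x : alternating (@tau_ext2 x).
Proof.
move=> v i j ij vij; rewrite /tau_ext2.
suff -> : \sum_(k < r.+1) (-1) ^+ k *: wedge (v k) (chi x (v \o lift k)) = 0
  :> ext2 x.
  by rewrite scaler0.
rewrite (bigD1 i) //= (bigD1 j) 1?eq_sym //= addrA [X in _ + X]big1 ?addr0; last first.
  move=> k /andP[ki kj].
  have [i' Ei] : exists i', i = lift k i'.
    by case: (unliftP k i) => [i' ->|ik]; [exists i'|rewrite ik eqxx in ki].
  have [j' Ej] : exists j', j = lift k j'.
    by case: (unliftP k j) => [j' ->|jk]; [exists j'|rewrite jk eqxx in kj].
  have ij' : i' != j' by move: ij; rewrite Ei Ej (inj_eq (@lift_inj _ k)).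
  rewrite (altform_alternating (chi x) ij') /= -?Ei -?Ej //.
  by rewrite wedge0r scaler0.
(* v \o lift j is v \o lift i up to a permutation p of sign -(-1)^(i+j) *)
pose t (m : 'I_r) := odflt m (unlift i (tperm i j (lift j m))).
have tE m : lift i (t m) = tperm i j (lift j m).
  rewrite /t; case: unliftP => [m' -> //|] E.
  have /eqP : lift j m = j by apply: (@perm_inj _ (tperm i j)); rewrite E tpermR.
  by rewrite eq_sym (negPf (neq_lift j m)).
have t_inj : injective t.
  move=> a b /(congr1 (lift i)); rewrite !tE => /perm_inj.
  exact: lift_inj.
pose p := perm t_inj.
have pE m : lift i (p m) = tperm i j (lift j m) by rewrite permE tE.
have vt : v \o lift j = (v \o lift i) \o p.
  apply: funext => m /=; rewrite pE.
  by case: tpermP => [->|->|].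
have sp : (-1) ^+ p = - (-1) ^+ (i + j)%N :> R.
  have := odd_tperm i j; rewrite ij.
  have -> : tperm i j = lift_perm j i p.
    apply/permP => k; case: (unliftP j k) => [m ->|->].
      by rewrite lift_perm_lift pE.
    by rewrite lift_perm_id tpermR.
  rewrite odd_lift_perm => h.
  rewrite -(signr_odd _ (i + j)) oddD.
  by move: h; case: (odd i); case: (odd j); case: (odd_perm p) => //= _;
     rewrite ?expr0 ?expr1 ?opprK.
rewrite vt (alt_perm (altform_multilinear (chi x))
  (altform_alternating (chi x))) -vij sp.
set c := chi x _.
rewrite wedgeZr scalerA mulrN -exprD addnC -addnA addnn exprD -mul2n exprM sqrrN.
by rewrite expr1n expr1n mulr1 scaleNr subrr.
Qed.

(* (v_1, ..., v_{r+1}) |-> g(chi(v_1, ..., v_r), v_{r+1}), an alternating form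
   of degree r+1. *)
Definition vcp_phi x (v : 'I_r.+1 -> tangent x) : R^o :=
  g x (chi x (v \o lift ord_max)) (v ord_max).

Lemma metricDl x (u v w : tangent x) : g x (u + v) w = g x u w + g x v w.
Proof. by have := metric_linear g w 1 u v; rewrite !scale1r. Qed.

Lemma metric0l x (w : tangent x) : g x 0 w = 0.
Proof. by apply: (addrI (g x 0 w)); rewrite -metricDl !addr0. Qed.

Lemma vcp_phi_multilinear x : multilinear (@vcp_phi x).
Proof.
move=> v i a u w; rewrite /vcp_phi.
have [->|ki] := eqVneq i ord_max.
  have E y : subst_at v ord_max y \o lift ord_max = v \o lift ord_max.
    by apply: funext => j; rewrite /subst_at /= eq_sym (negPf (neq_lift _ j)).
  rewrite !E /subst_at !eqxx !(metric_symmetric g (chi x _)).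
  by rewrite (metric_linear g).
have [i' ->] : exists i', i = lift ord_max i'.
  by case: (unliftP ord_max i) => [i' ->|ik]; [exists i'|rewrite ik eqxx in ki].
have E y : subst_at v (lift ord_max i') y \o lift ord_max
         = subst_at (v \o lift ord_max) i' y.
  by apply: funext => j; rewrite /subst_at /= (inj_eq (@lift_inj _ _)).
rewrite !E (altform_multilinear (chi x)).
have E' y : subst_at v (lift ord_max i') y ord_max = v ord_max.
  by rewrite /subst_at (negPf (neq_lift _ i')).
by rewrite !E' (metric_linear g).
Qed.

Lemma vcp_phi_alternating x : alternating (@vcp_phi x).
Proof.
move=> v i j; wlog : i j / (i < j)%N => [hw ij vij|ij _ vij].
  by move: (ij); rewrite neq_ltn => /orP[/hw|/hw]; apply; rewrite // eq_sym.
have /eqP im : i != ord_max.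
  by apply: contraTneq ij => ->; rewrite -leqNgt -ltnS ltn_ord.
have [i' Ei] : exists i', i = lift ord_max i'.
  by case: (unliftP ord_max i) => [i' ->|]; [exists i'|].
rewrite /vcp_phi; case: (unliftP ord_max j) => [j' Ej|Ej].
  have ij' : i' != j'.
    by apply: contraTneq ij => E; rewrite Ei Ej E ltnn.
  by rewrite (altform_alternating (chi x) ij') ?metric0l //= -Ei -Ej.
have -> : v ord_max = (v \o lift ord_max) i' by rewrite /= -Ei vij Ej.
exact: (vcp_orthogonal chi (v \o lift ord_max)).
Qed.

Lemma tau_gperp x (v : 'I_r.+1 -> tangent x) : tau_ext2 v \in annihilates_g x.
Proof.
apply: rpredZ; apply/asboolP => zeta [so inv].
have pD B C : pairing (two_form zeta) (B + C)
    = pairing (two_form zeta) B + pairing (two_form zeta) C.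
  by have := pairingP (two_form zeta) 1 B C; rewrite scale1r mul1r.
have p0 : pairing (two_form zeta) 0 = 0.
  by apply: (addrI (pairing (two_form zeta) 0)); rewrite -pD !addr0.
have pZ a B : pairing (two_form zeta) (a *: B)
    = a * pairing (two_form zeta) B.
  by have := pairingP (two_form zeta) a B 0; rewrite addr0 p0 addr0.
rewrite (big_morph (pairing (two_form zeta)) pD p0).
have term (k : 'I_r.+1) : pairing (two_form zeta)
      ((-1) ^+ k *: wedge (v k) (chi x (v \o lift k)))
    = (-1) ^+ r * vcp_phi (subst_at v k (zeta (v k))).
  rewrite pZ pairing_wedge; last first.
  - move=> w; rewrite /two_form.
    have : g x (zeta w) w = - g x (zeta w) w by rewrite {1}so metric_symmetric.
    by move/eqP; rewrite -addr_eq0 -mulr2n mulrn_eq0 /= => /eqP.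
  - move=> w a u u'; rewrite /two_form linearP; exact: (metric_linear g).
  - move=> w a u u'; rewrite /two_form !(metric_symmetric g (zeta w)).
    exact: (metric_linear g).
  rewrite /two_form.
  have := alt_perm (@vcp_phi_multilinear x) (@vcp_phi_alternating x)
    (lift_perm ord_max k 1) (subst_at v k (zeta (v k))).
  rewrite {1}/vcp_phi /= lift_perm_id {2}/subst_at eqxx.
  have -> : (subst_at v k (zeta (v k)) \o lift_perm ord_max k 1) \o lift ord_max
      = v \o lift k.
    apply: funext => j /=; rewrite lift_perm_lift perm1 /subst_at.
    by rewrite eq_sym (negPf (neq_lift k j)).
  rewrite metric_symmetric => ->; rewrite odd_lift_perm odd_perm1 addbF /=.
  rewrite signr_addb !signr_odd /GRing.scale /= mulrA; congr (_ * _).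
  by rewrite mulrCA -expr2 sqrr_sign mulr1.
rewrite (eq_bigr _ (fun k _ => term k)) -mulr_sumr.
suff -> : \sum_(k < r.+1) vcp_phi (subst_at v k (zeta (v k))) = 0.
  by rewrite mulr0.
rewrite big_ord_recr /=.
have -> : vcp_phi (subst_at v ord_max (zeta (v ord_max)))
    = g x (chi x (v \o lift ord_max)) (zeta (v ord_max)).
  rewrite /vcp_phi {2}/subst_at eqxx; congr (g x (chi x _) _).
  apply: funext => j; rewrite /subst_at /= eq_sym.
  by rewrite (negPf (neq_lift (@ord_max r) j)).
apply/eqP; rewrite addr_eq0 -so inv; apply/eqP.
rewrite (big_morph (fun u => g x u (v ord_max)) (fun u w => metricDl u w _)
  (metric0l _)).
apply: eq_bigr => j _; rewrite /vcp_phi.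
have -> : widen_ord (leqnSn r) j = lift ord_max j.
  by apply: val_inj; rewrite /= /bump leqNgt ltn_ord.
rewrite {2}/subst_at (negPf (neq_lift (@ord_max r) j)); congr (g x (chi x _) _).
by apply: funext => i; rewrite /subst_at /= (inj_eq (@lift_inj _ (@ord_max r))).
Qed.

Definition tau_fun x (v : 'I_r.+1 -> tangent x) : gperp x :=
  Gperp (tau_gperp v).

Lemma tau_multilinear x : multilinear (@tau_fun x).
Proof.
move=> v i a u w; apply: val_inj.
by rewrite [RHS]linearP; exact: tau_ext2_multilinear.
Qed.

Lemma tau_alternating x : alternating (@tau_fun x).
Proof.
by move=> v i j ij vij; apply: val_inj; exact: tau_ext2_alternating ij vij.
Qed.

Definition tau x : altform r.+1 (tangent x) (gperp x) :=
  Altform (@tau_multilinear x) (@tau_alternating x).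

(* (r+1)-forms on A with values in the pullback of g_M^perp, as sections that
   are not required to be smooth: vanishing is a pointwise matter. *)
Definition perp_form (A : submanifold M r.+1) : Type :=
  forall a : A, altform r.+1 (tangent a) (gperp (inclusion A a)).

Definition perp_form0 (A : submanifold M r.+1) : perp_form A :=
  fun a => altform0 r.+1 (tangent a) (gperp (inclusion A a)).

Definition tau_restriction (A : submanifold M r.+1) : perp_form A :=
  fun a => altform_pullback (tau (inclusion A a)) (tmap_linear (inclusion A) a).

End Tau.

Arguments g_fibre {R n M g r} chi x : rename.
Arguments annihilates_g {R n M g r} chi x : rename.
Arguments gperp {R n M g r} chi x : rename.
Arguments tau {R n M g r} chi x : rename.
Arguments perp_form {R n M g r} chi A : rename.
Arguments perp_form0 {R n M g r} chi A : rename.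
Arguments tau_restriction {R n M g r} chi A : rename.

(* Main.v *)
From HB Require Import structures.
Require Import Defs.
From mathcomp Require Import all_boot all_order all_algebra.
From mathcomp Require Import all_fingroup.
From mathcomp Require Import all_classical all_reals all_analysis.

(** Both conditions are pointwise in a, so the theorem is linear algebra on
    V = T_x M, with P = T_a A a subspace of dimension r+1.  Given v_0, ..., v_r
    in P, put w_k = (-1)^k chi(v_0, ..., omit v_k, ..., v_r), so that tau(v) is
    a positive multiple of the bivector \sum_k v_k /\ w_k.

    If P is preserved by chi, it suffices to treat a basis v of P, as tau
    vanishes on dependent tuples ([alternating_dependent]).  Then
    w_k = \sum_j H_kj v_j for some matrix H, and
    \sum_k v_k /\ w_k = \sum_(k,j) H_kj v_k /\ v_j vanishes as soon as H is
    symmetric ([wedge_sum_symmetric]).  The symmetry comes from the fact that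
    g(chi(v_1, ..., v_r), v_(r+1)) is alternating: it gives
    g(w_k, v_j) = d delta_kj with d independent of k ([metric_omit]), that is
    H S = d I for the Gram matrix S of v.  As S is symmetric, H is
    proportional to its inverse, or w = 0 in the degenerate case d = 0
    ([tau_ext2_eq0_of_span]).

    Conversely, suppose tau vanishes on P and chi(v_1, ..., v_r) is not in P
    for some v_i in P.  A linear form c vanishing on P, but not on
    chi(v_1, ..., v_r), contracts the equation \sum_k v_k /\ w_k = 0 to
    \sum_k c(w_k) v_k = 0 ([wedge_sum_contract]).  Here c(w_0) is nonzero, so
    every v_0 in P is a combination of v_1, ..., v_r, which is absurd since
    dim P = r+1 ([preserved_of_tau_ext2_vanish]). *)

Set Implicit Arguments.
Unset Strict Implicit.
Unset Printing Implicit Defensive.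

Import Order.TTheory GRing.Theory Num.Theory.
Local Open Scope classical_set_scope.
Local Open Scope ring_scope.

(** * Alternating maps on dependent tuples *)

Lemma multilinear_subst0 (R : pzRingType) (V W : lmodType R) (r : nat)
    (f : ('I_r -> V) -> W) (v : 'I_r -> V) (i : 'I_r) :
  multilinear f -> f (subst_at v i 0) = 0.
Proof.
by move=> fm; have := fm v i (-1) 0 0; rewrite scaler0 addr0 scaleN1r addNr.
Qed.

Lemma multilinear_subst_sum (R : pzRingType) (V W : lmodType R) (r : nat)
    (f : ('I_r -> V) -> W) (v : 'I_r -> V) (i : 'I_r)
    (m : nat) (c : 'I_m -> R) (u : 'I_m -> V) :
  multilinear f ->
  f (subst_at v i (\sum_j c j *: u j)) = \sum_j c j *: f (subst_at v i (u j)).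
Proof.
move=> fm.
apply: (big_ind2 (fun x y => f (subst_at v i x) = y)).
- exact: multilinear_subst0.
- by move=> x1 x2 y1 y2 <- <-; exact: multilinearD.
- move=> j _; have := fm v i (c j) (u j) 0.
  by rewrite multilinear_subst0 // !addr0.
Qed.

(** Replacing v_i by the zero vector \sum_j c_j v_j and expanding leaves only
    the term j = i, since the others repeat an entry; hence c_i f(v) = 0. *)
Lemma alternating_dependent (F : fieldType) (V W : lmodType F) (r : nat)
    (f : ('I_r -> V) -> W) (v : 'I_r -> V) (c : 'I_r -> F) (i : 'I_r) :
  multilinear f -> Defs.alternating f ->
  \sum_j c j *: v j = 0 -> c i != 0 -> f v = 0.
Proof.
move=> fm fa cv ci; apply/eqP.
suff : c i *: f v == 0 by rewrite scaler_eq0 (negPf ci).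
have := multilinear_subst_sum v i c v fm.
rewrite cv multilinear_subst0 // (bigD1 i) //= big1; last first.
  move=> j ji; rewrite (fa _ i j) ?scaler0 //; first by rewrite eq_sym.
  by rewrite /subst_at eqxx (negPf ji).
have -> : subst_at v i (v i) = v.
  by apply: funext => j; rewrite /subst_at; case: eqP => [->|].
by rewrite addr0 => <-.
Qed.

(** * Sums of decomposable bivectors *)

Lemma wedge_sum_mx (R : comPzRingType) (n m : nat) (v w : 'I_m -> 'rV[R]_n) :
  bivector_mx (\sum_k wedge (v k) (w k)) =
    (\matrix_k v k)^T *m (\matrix_k w k) - (\matrix_k w k)^T *m (\matrix_k v k).
Proof.
rewrite -[LHS]/(val _) raddf_sum /=.
apply/matrixP => i j; rewrite summxE !mxE -sumrB; apply: eq_bigr => k _.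
by rewrite !mxE !big_ord1 !mxE.
Qed.

(** Interior product of the bivector with the linear form c, of which only the
    half c(w_k) v_k survives because c kills the v_k. *)
Lemma wedge_sum_contract (R : comPzRingType) (n m : nat)
    (v w : 'I_m -> 'rV[R]_n) (c : 'cV[R]_n) :
  \sum_k wedge (v k) (w k) = 0 -> (forall k, v k *m c = 0) ->
  \sum_k (w k *m c) 0 0 *: v k = 0.
Proof.
move=> vw0 vc.
have Vc : (\matrix_k v k) *m c = 0.
  by apply/row_matrixP => k; rewrite row_mul rowK vc row0.
have := wedge_sum_mx v w; rewrite vw0 => /(congr1 (mulmx^~ c)).
rewrite mul0mx mulmxBl -!mulmxA Vc mulmx0 subr0 => /(congr1 trmx).
rewrite trmx0 trmx_mul trmxK mulmx_sum_row => E.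
rewrite [RHS]E; apply: eq_bigr => k _; rewrite rowK !mxE; congr (_ *: _).
by apply: eq_bigr => l _; rewrite mxE.
Qed.

(** With V the matrix of rows v_k, the bivector is V^T H V - V^T H^T V. *)
Lemma wedge_sum_symmetric (R : comPzRingType) (n m : nat)
    (v : 'I_m -> 'rV[R]_n) (H : 'M[R]_m) :
  H^T = H -> \sum_k wedge (v k) (\sum_j H k j *: v j) = 0.
Proof.
move=> Hs; apply: val_inj; rewrite [LHS]wedge_sum_mx.
have -> : \matrix_k (\sum_j H k j *: v j) = H *m (\matrix_k v k).
  apply/row_matrixP => k; rewrite rowK row_mul mulmx_sum_row.
  by apply: eq_bigr => j _; rewrite rowK !mxE.
by rewrite trmx_mul Hs mulmxA subrr.
Qed.

(** * The cross product and tau on a single tangent space *)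

Section Pointwise.
Context {R : realType} {n : nat} {M : manifold R n}.
Context {g : riemannian_metric M} {r : nat} (chi : vcp g r) (x : M).

(** Moving the signs onto the cross products puts tau in the form
    \sum_k v_k /\ w_k to which the bivector lemmas apply. *)
Lemma tau_ext2_eq0 (v : 'I_r.+1 -> tangent x) :
  tau_ext2 chi v = 0 <->
  \sum_k wedge (v k) ((-1) ^+ k *: chi x (v \o lift k)) = 0.
Proof.
have -> : \sum_k wedge (v k) ((-1) ^+ k *: chi x (v \o lift k))
    = \sum_(k < r.+1) (-1) ^+ k *: wedge (v k) (chi x (v \o lift k)).
  by apply: eq_bigr => k _; rewrite wedgeZr.
rewrite /tau_ext2; split=> [/eqP|->]; last exact: scaler0.
by rewrite scaler_eq0 invr_eq0 sqrtr_eq0 lern0 /= => /eqP.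
Qed.

Lemma metricZl a (u w : tangent x) : g x (a *: u) w = a * g x u w.
Proof. by have := metric_linear g w a u 0; rewrite addr0 metric0l addr0. Qed.

Lemma metric_suml (m : nat) (c : 'I_m -> R) (u : 'I_m -> tangent x)
    (w : tangent x) :
  g x (\sum_j c j *: u j) w = \sum_j c j * g x (u j) w.
Proof.
apply: (big_ind2 (fun a b => g x a w = b)); first exact: metric0l.
- by move=> a1 a2 b1 b2 <- <-; exact: metricDl.
- by move=> j _; exact: metricZl.
Qed.

(** Off the diagonal this is the orthogonality of chi to its arguments.  On the
    diagonal, g(chi(omit v_k), v_k) is the (r+1)-form [vcp_phi] after the cycle
    moving the index k to the last place, whose sign is (-1)^(r+k). *)
Lemma metric_omit (v : 'I_r.+1 -> tangent x) (k j : 'I_r.+1) :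
  g x ((-1) ^+ k *: chi x (v \o lift k)) (v j)
    = (k == j)%:R * ((-1) ^+ r * vcp_phi chi v).
Proof.
rewrite metricZl; case: (unliftP k j) => [j' ->|->].
  rewrite (negPf (neq_lift k j')) mul0r.
  by rewrite (vcp_orthogonal chi (v \o lift k) j') mulr0.
rewrite eqxx mul1r.
have := alt_perm (@vcp_phi_multilinear _ _ _ _ _ chi x)
  (@vcp_phi_alternating _ _ _ _ _ chi x) (lift_perm ord_max k 1) v.
rewrite {1}/vcp_phi /= lift_perm_id.
have -> : (v \o lift_perm ord_max k 1) \o lift ord_max = v \o lift k.
  by apply: funext => j' /=; rewrite lift_perm_lift perm1.
move=> ->; rewrite odd_lift_perm odd_perm1 addbF /= signr_addb !signr_odd.
by rewrite /GRing.scale /= mulrA mulrCA -expr2 sqrr_sign mulr1.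
Qed.

(** Symmetry of H without inverting the Gram matrix S: from H S = d I and
    S^T = S one gets d H^T = H S H^T = d H.  When d = 0 the vectors
    w_k = \sum_j H_kj v_j are orthogonal to all the v_j, hence to themselves. *)
Lemma tau_ext2_eq0_of_span (v : 'I_r.+1 -> tangent x) (H : 'M[R]_r.+1) :
  (forall k : 'I_r.+1,
     (-1) ^+ k *: chi x (v \o lift k) = \sum_j H k j *: v j) ->
  tau_ext2 chi v = 0.
Proof.
move=> wE; apply/tau_ext2_eq0.
pose S := \matrix_(i, j) g x (v i) (v j).
set d := (-1) ^+ r * vcp_phi chi v.
have HS : H *m S = d%:M.
  apply/matrixP => k i; rewrite !mxE -mulr_natl -metric_omit wE metric_suml.
  by apply: eq_bigr => j _; rewrite mxE.
have St : S^T = S by apply/matrixP => i j; rewrite !mxE metric_symmetric.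
have SHt : S *m H^T = d%:M by rewrite -{1}St -trmx_mul HS tr_scalar_mx.
have [d0|dn0] := eqVneq d 0.
  rewrite big1 // => k _.
  suff -> : (-1) ^+ k *: chi x (v \o lift k) = 0 by rewrite wedge0r.
  apply/eqP; apply: contraT => /(metric_pos g).
  rewrite {1}wE metric_suml big1 ?ltxx // => j _.
  by rewrite metric_symmetric metric_omit -/d d0 !mulr0.
under eq_bigr do rewrite wE.
apply: wedge_sum_symmetric.
apply: (scalerI dn0); rewrite -mul_scalar_mx -HS -mulmxA SHt.
by rewrite mul_mx_scalar.
Qed.

(** Either u is dependent and tau vanishes because it is alternating, or u is a
    basis and the cross products, lying in the range of T, are combinations of
    the T u_j. *)
Lemma tau_ext2_vanish_of_preserved (T : {linear 'rV[R]_r.+1 -> tangent x}) :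
  (forall v, (forall i, range T (v i)) -> range T (chi x v)) ->
  forall u : 'I_r.+1 -> 'rV[R]_r.+1, tau_ext2 chi (T \o u) = 0.
Proof.
move=> pres u; pose U := \matrix_i u i.
have [/eqP/det0P[c c0 cU]|detU] := eqVneq (\det U) 0.
  have [i ci] : exists i, c 0 i != 0 by apply/rV0Pn.
  apply: (alternating_dependent (c := c 0) (i := i)) => //.
  - exact: tau_ext2_multilinear.
  - exact: tau_ext2_alternating.
  rewrite -[RHS](linear0 T) -cU mulmx_sum_row linear_sum.
  by apply: eq_bigr => j _; rewrite rowK linearZ.
have Uu : U \in unitmx by rewrite unitmxE unitfE.
have chiT (k : 'I_r.+1) : exists y : 'rV[R]_r.+1,
    (-1) ^+ k *: chi x ((T \o u) \o lift k) = T y.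
  have [i|y _ Ty] := pres ((T \o u) \o lift k); first by exists (u (lift k i)).
  by exists ((-1) ^+ k *: y); rewrite linearZ Ty.
have [y yE] := choice chiT.
(* The coordinates of y_k in the basis u are the row y_k U^-1. *)
apply: (@tau_ext2_eq0_of_span _ ((\matrix_k y k) *m invmx U)) => k.
rewrite yE -[y k](rowK y) -[X in row k X](mulmxKV Uu) row_mul mulmx_sum_row.
rewrite linear_sum; apply: eq_bigr => j _.
by rewrite linearZ /= rowK [X in X *: _]mxE.
Qed.

(** Arguing by contradiction spares the reduction to basis vectors: a value
    chi(v) outside the range of T forces that range, of dimension r+1, into the
    span of the r vectors v_i. *)
Lemma preserved_of_tau_ext2_vanish (T : {linear 'rV[R]_r.+1 -> tangent x}) :
  injective T ->
  (forall u : 'I_r.+1 -> 'rV[R]_r.+1, tau_ext2 chi (T \o u) = 0) ->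
  forall v, (forall i, range T (v i)) -> range T (chi x v).
Proof.
move=> Tinj tau0 v vT.
have vE i : exists y : 'rV[R]_r.+1, T y = v i.
  by have [y _ yE] := vT i; exists y.
have [u uE] := choice vE.
pose B : 'M[R]_(r.+1, n) := lin1_mx T.
have TB y : T y = y *m B by rewrite mul_rV_lin1.
have rB : \rank B = r.+1.
  apply/eqP; rewrite -[_ == _]/(row_free B) -kermx_eq0.
  apply/eqP/row_matrixP => i; apply: Tinj.
  by rewrite TB -row_mul mulmx_ker row0 row0 linear0.
suff /submxP[y yE] : (chi x v <= B)%MS by exists y; rewrite // TB -yE.
rewrite submxE; apply: contraT => /rV0Pn[j cj].
(* A column of the cokernel is a linear form vanishing on the range of T. *)
pose c := col j (cokermx B).
have Bc : B *m c = 0 by rewrite /c colE mulmxA mulmx_coker mul0mx.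
have cv : (chi x v *m c) 0 0 != 0.
  by rewrite /c colE mulmxA -colE mxE.
have Bv : (B <= (\matrix_i v i : 'M[R]_(r, n)))%MS.
  apply/row_subP => i.
  (* T maps w to the tuple (row i B, v_1, ..., v_r). *)
  pose w (k : 'I_r.+1) :=
    if unlift ord0 k is Some l then u l else delta_mx 0 i.
  have wc k : (T \o w) k *m c = 0 by rewrite /= TB -mulmxA Bc mulmx0.
  have /tau_ext2_eq0/(wedge_sum_contract (c := c))/(_ wc) := tau0 w.
  rewrite big_ord_recl /= expr0 scale1r.
  have -> : (T \o w) \o lift ord0 = v.
    by apply: funext => l /=; rewrite /w liftK uE.
  rewrite {1}/w unlift_none TB -rowE => /eqP; rewrite addr_eq0 => /eqP rowE0.
  rewrite -(eqmx_scale _ cv) rowE0 eqmx_opp.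
  apply: summx_sub => l _; apply: scalemx_sub.
  by rewrite /= /w liftK uE -[v l](rowK v) row_sub.
by have := mxrankS Bv; rewrite rB leqNgt ltnS rank_leq_row.
Qed.
End Pointwise.

(** * Instantons *)

Theorem theorem15 (R : realType) (n : nat) (M : manifold R n)
    (g : riemannian_metric M) (r : nat) (chi : vcp g r)
    (A : submanifold M r.+1) :
  instanton chi A <-> tau_restriction chi A = perp_form0 chi A.
Proof.
pose T a : {linear 'rV[R]_r.+1 -> tangent (inclusion A a)} :=
  HB.pack (tmap (inclusion A) a)
    (GRing.isLinear.Build _ _ _ _ _ (tmap_linear (inclusion A) a)).
split=> [inst|tau0 a].
  apply: functional_extensionality_dep => a; apply: altform_eq => u.
  apply: val_inj.
  exact: (@tau_ext2_vanish_of_preserved _ _ _ _ _ chi _ (T a) (inst a)).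
apply: (@preserved_of_tau_ext2_vanish _ _ _ _ _ chi _ (T a)).
  exact: inclusion_immersion.
move=> u.
have /(congr1 (fun f => f u)) := congr1 (fun F => altform_fun (F a)) tau0.
exact: (congr1 val).
Qed.
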